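(* Let $\Omega\subset\mathbb{R}^n$ be a bounded domain with Lipschitz boundary, let $\varrho>0$ and let $\{Y_k\}_{k\in\mathbb{N}}\subset L^\infty(\Omega;\mathbb{R}^{n\times n})$ satisfy $Y_k(x)\in R^{n\times n}_\varrho$ for almost all $x\in\Omega$ and all $k\in\mathbb{N}$. If $\{Y_k\}$ generates $\nu\in\mathcal{Y}^\infty(\Omega;\mathbb{R}^{n\times n})$ and $\{Y_k^{-1}\}$ generates $\mu\in\mathcal{Y}^\infty(\Omega;\mathbb{R}^{n\times n})$, then for almost all $x\in\Omega$ and every continuous $f:R^{n\times n}_\varrho\to\mathbb{R}$ $$\int_{R^{n\times n}_\varrho}f(s)\,\mu_x(\mathrm{d}s)=\int_{R^{n\times n}_\varrho}f(s^{-1})\,\nu_x(\mathrm{d}s).$$ Moreover, $\operatorname{supp}\nu_x\subset R^{n\times n}_\varrho$ for almost all $x\in\Omega$.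
   Context: $|A|$ is the Frobenius norm on $\mathbb{R}^{n\times n}$ and $R^{n\times n}_\varrho:=\{A\in\mathbb{R}^{n\times n}:A\text{ invertible},\ \max(|A|,|A^{-1}|)\le\varrho\}$. $Y_k^{-1}$ is the pointwise matrix inverse. A Young measure is a family $\nu=\{\nu_x\}_{x\in\Omega}$ of Radon probability measures on $\mathbb{R}^{n\times n}$ such that $x\mapsto\int v\,\mathrm{d}\nu_x$ is measurable for all $v\in C_0(\mathbb{R}^{n\times n})$. A bounded sequence $\{Y_k\}\subset L^\infty(\Omega;\mathbb{R}^{n\times n})$ generates $\nu$ if for all $v\in C(\mathbb{R}^{n\times n})$, $v\circ Y_k\to\int v(s)\,\nu_x(\mathrm{d}s)$ weakly* in $L^\infty(\Omega)$. $\mathcal{Y}^\infty(\Omega;\mathbb{R}^{n\times n})$ is the set of Young measures generated by bounded sequences in $L^\infty(\Omega;\mathbb{R}^{n\times n})$. *)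

(* Defs.v *)
From HB Require Import structures.
From mathcomp Require Import all_boot all_order all_algebra.
From mathcomp Require Import all_classical all_reals all_analysis.

Set Implicit Arguments.
Unset Strict Implicit.
Unset Printing Implicit Defensive.

Import Order.TTheory GRing.Theory Num.Theory.
Import numFieldNormedType.Exports.

Local Open Scope classical_set_scope.
Local Open Scope ring_scope.

(* Dimensions are written n.+1: in dimension 0 the box outer measure below
   would give the empty set mass 1. *)
Section lebesgue_Rn.
Context {R : realType} {n : nat}.

(* Boxes are half-open; p is the pair of the lower and upper corners. *)
Definition box (p : 'rV[R]_n.+1 * 'rV[R]_n.+1) : set 'rV[R]_n.+1 :=
  [set x | forall i, p.1 ord0 i < x ord0 i <= p.2 ord0 i].

Definition box_volume (p : 'rV[R]_n.+1 * 'rV[R]_n.+1) : \bar R :=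
  (\prod_(i < n.+1) Num.max 0 (p.2 ord0 i - p.1 ord0 i))%:E.

Definition box_cover (A : set 'rV[R]_n.+1) :
    set (nat -> 'rV[R]_n.+1 * 'rV[R]_n.+1) :=
  [set p | A `<=` \bigcup_k box (p k)].

Definition lebesgue_outer (A : set 'rV[R]_n.+1) : \bar R :=
  ereal_inf [set (\sum_(0 <= k <oo) box_volume (p k))%E | p in box_cover A].

Lemma box_volume_ge0 p : (0 <= box_volume p)%E.
Proof. by rewrite lee_fin prodr_ge0// => i _; rewrite le_max lexx. Qed.

Lemma lebesgue_outer_ge0 A : (0 <= lebesgue_outer A)%E.
Proof.
apply: le_ereal_inf_tmp => _ [p _ <-].
by apply: nneseries_ge0 => k _ _; exact: box_volume_ge0.
Qed.

Lemma lebesgue_outer0 : lebesgue_outer set0 = 0%E.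
Proof.
apply/eqP; rewrite eq_le lebesgue_outer_ge0 andbT.
apply: ereal_inf_lbound; exists (fun=> (0, 0)) => //=.
rewrite eseries0// => k _ _.
by rewrite /box_volume big_ord_recl/= subrr maxxx mul0r.
Qed.

Lemma lebesgue_outer_le : {homo lebesgue_outer : A B / A `<=` B >-> (A <= B)%E}.
Proof.
move=> A B AB; apply/ereal_inf_le_tmp => _ [p Bp <-].
by exists p => //; exact: subset_trans Bp.
Qed.

Lemma lebesgue_outer_sigma_subadditive : sigma_subadditive lebesgue_outer.
Proof.
move=> A; have [[i ioo]|] := pselect (exists i, lebesgue_outer (A i) = +oo%E).
  rewrite (eseries_pinfty _ _ ioo) ?leey// => k _.
  by rewrite -ltNye (lt_le_trans _ (lebesgue_outer_ge0 _)).
rewrite -forallNE => Aoo.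
apply/lee_addgt0Pr => e e0.
rewrite (le_trans _ (epsilon_trick _ _ (ltW e0)))//; last first.
  by move=> k; exact: lebesgue_outer_ge0.
have [G PG] : {G : nat -> nat -> 'rV[R]_n.+1 * 'rV[R]_n.+1 & forall k,
    box_cover (A k) (G k) /\
    (\sum_(0 <= j <oo) box_volume (G k j) <=
      lebesgue_outer (A k) + (e / (2 ^ k.+1)%:R)%:E)%E}.
  apply: (@choice _ _ (fun k (p : nat -> 'rV[R]_n.+1 * 'rV[R]_n.+1) =>
    box_cover (A k) p /\ (\sum_(0 <= j <oo) box_volume (p j) <=
      lebesgue_outer (A k) + (e / (2 ^ k.+1)%:R)%:E)%E)) => k.
  have en : 0 < e / (2 ^ k.+1)%:R by rewrite divr_gt0// ltr0n expn_gt0.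
  have fA : lebesgue_outer (A k) \is a fin_num.
    by rewrite ge0_fin_numE ?lebesgue_outer_ge0// ltey; exact/eqP/Aoo.
  have [_ [p Ap <-] /ltW pA] := lb_ereal_inf_adherent en fA.
  by exists p.
have vG0 (x : nat * nat) : (0 <= box_volume (uncurry G x))%E.
  exact: box_volume_ge0.
apply: (@le_trans _ _ (\esum_(i in setT) box_volume (uncurry G i))%E).
  apply: ereal_inf_lbound => /=.
  have /card_esym/ppcard_eqP[f] := card_nat2.
  exists (uncurry G \o f).
    move=> t [i _ Ait]; have [j _ Gij] := (PG i).1 _ Ait.
    by exists (f^-1%FUN (i, j)) => //=; rewrite invK ?inE.
  rewrite nneseries_esumT; last by move=> k; exact: box_volume_ge0.
  rewrite [RHS](reindex_esum [set: nat] setT f)//=.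
rewrite (_ : esum _ _ = \sum_(0 <= i <oo) \sum_(0 <= j <oo) box_volume (G i j))%E.
  apply: lee_nneseries => [i _ _|i _]; last exact: (PG i).2.
  by apply: nneseries_ge0 => *; exact: box_volume_ge0.
rewrite nneseries_esumT; last first.
  by move=> i; apply: nneseries_ge0 => *; exact: box_volume_ge0.
rewrite (eq_esum (b := fun i => \esum_(j in [set: nat]) box_volume (G i j))%E); last first.
  by move=> i _; rewrite nneseries_esumT// => *; exact: box_volume_ge0.
rewrite esum_esum; last by move=> *; exact: box_volume_ge0.
suff -> : [set: nat] `*`` (fun=> [set: nat]) = [set: nat * nat].
  by apply: eq_esum => -[].
by apply/seteqP; split.
Qed.

HB.instance Definition _ := isOuterMeasure.Build R 'rV[R]_n.+1 lebesgue_outer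
  lebesgue_outer0 lebesgue_outer_ge0 lebesgue_outer_le
  lebesgue_outer_sigma_subadditive.

End lebesgue_Rn.

(* R^(n+1) with its Lebesgue (i.e. Caratheodory-measurable) sets. *)
Definition Rn (R : realType) (n : nat) :=
  caratheodory_type (@lebesgue_outer R n).

Definition leb {R : realType} {n : nat} : set (Rn R n) -> \bar R :=
  @lebesgue_outer R n.

HB.instance Definition _ (R : realType) (n : nat) :=
  isMeasure.Build _ (Rn R n) R (@leb R n)
    (caratheodory_measure0 (@lebesgue_outer R n))
    (caratheodory_measure_ge0 (mu := @lebesgue_outer R n))
    (caratheodory_measure_sigma_additive (mu := @lebesgue_outer R n)).

(* Square matrices with their Borel sets. *)
Definition Mn (R : realType) (n : nat) :=
  g_sigma_algebraType (@open 'M[R]_n.+1).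

Section domains.
Context {R : realType} {n : nat}.
Implicit Types Omega : set 'rV[R]_n.+1.

Definition domain Omega := [/\ open Omega, connected Omega & Omega !=set0].

(* Near every boundary point, up to a rigid motion, Omega is the strict
   epigraph of a Lipschitz function; the last coordinate is the vertical
   direction and [col' ord_max] keeps the other n coordinates. *)
Definition lipschitz_boundary Omega :=
  forall x, (closure Omega `\` interior Omega) x ->
  exists (Q : 'M[R]_n.+1) (g : 'rV[R]_n -> R) (r : R),
  [/\ Q *m Q^T = 1%:M, lipschitz g, 0 < r &
      forall y, ball x r y ->
        (Omega y <->
         g (col' ord_max ((y - x) *m Q)) < ((y - x) *m Q) ord0 ord_max)].

Definition bounded_lipschitz_domain Omega :=
  [/\ domain Omega, bounded_set Omega & lipschitz_boundary Omega].

End domains.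

Section matrices.
Context {R : realType} {n : nat}.

Definition frobenius (A : 'M[R]_n.+1) : R :=
  Num.sqrt (\sum_i \sum_j A i j ^+ 2).

Definition Rrho (rho : R) : set 'M[R]_n.+1 :=
  [set A | A \in unitmx /\ Num.max (frobenius A) (frobenius (invmx A)) <= rho].

Definition C0 : set ('M[R]_n.+1 -> R) :=
  [set v | continuous v /\ forall e, 0 < e ->
    exists2 K, compact K & forall A, ~ K A -> `|v A| < e].

(* For a finite Borel measure, being Radon amounts to inner regularity. *)
Definition radon (m : probability (Mn R n) R) :=
  forall A : set (Mn R n), measurable A ->
    m A = ereal_sup [set m K | K in
      [set K : set 'M[R]_n.+1 | compact K /\ K `<=` A]].

Definition supp (m : probability (Mn R n) R) : set 'M[R]_n.+1 :=
  [set A | forall U : set 'M[R]_n.+1, open U -> U A -> (0 < m U)%E].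

End matrices.

Section young_measures.
Context {R : realType} {n : nat}.
Variable Omega : set (Rn R n).

Definition Linfty (u : Rn R n -> R) :=
  measurable_fun Omega u /\
  exists M : R, {ae leb, forall x, Omega x -> `|u x| <= M}.

Definition Linfty_mx (Y : Rn R n -> Mn R n) :=
  measurable_fun Omega Y /\
  exists M : R, {ae leb, forall x, Omega x -> frobenius (Y x) <= M}.

Definition bounded_in_Linfty_mx (Y : nat -> Rn R n -> Mn R n) :=
  (forall k, Linfty_mx (Y k)) /\
  exists M : R, forall k, {ae leb, forall x, Omega x -> frobenius (Y k x) <= M}.

(* Weak* convergence in Linfty = (L^1)^*. *)
Definition weak_star_cvg (u : nat -> Rn R n -> R) (l : Rn R n -> R) :=
  [/\ forall k, Linfty (u k), Linfty l &
      forall phi : Rn R n -> R, leb.-integrable Omega (EFin \o phi) ->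
        \int[leb]_(x in Omega) (u k x * phi x) @[k --> \oo] -->
        \int[leb]_(x in Omega) (l x * phi x)].

(* The values of nu outside Omega are irrelevant. *)
Definition young_measure (nu : Rn R n -> probability (Mn R n) R) :=
  (forall x, Omega x -> radon (nu x)) /\
  forall v, C0 v -> measurable_fun Omega (fun x => \int[nu x]_s v s).

(* The integrability clause makes the integral of v against nu x, which is
   0 by convention when it diverges, meaningful. *)
Definition generates (Y : nat -> Rn R n -> Mn R n)
    (nu : Rn R n -> probability (Mn R n) R) :=
  bounded_in_Linfty_mx Y /\
  forall v : 'M[R]_n.+1 -> R, continuous v ->
    {ae leb, forall x, Omega x -> (nu x).-integrable setT (EFin \o v)} /\
    weak_star_cvg (fun k x => v (Y k x)) (fun x => \int[nu x]_s v s).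

Definition Yinfty (nu : Rn R n -> probability (Mn R n) R) :=
  young_measure nu /\ exists Y, generates Y nu.

End young_measures.

(* Main.v *)
Require Import Defs.
From HB Require Import structures.
From mathcomp Require Import all_boot all_order all_algebra perm.
From mathcomp Require Import all_classical all_reals all_analysis.
From mathcomp Require Import measurable_realfun lra.

Import Order.TTheory GRing.Theory Num.Theory.
Import numFieldNormedType.Exports.

Local Open Scope classical_set_scope.
Local Open Scope ring_scope.

(* Let K = Rrho rho and let g be a continuous map on all matrices extending
   A |-> A^-1 from K (g = det / max(det^2, c) *: adj for a small c > 0). If
   continuous v, w satisfy v(Y_k) = w(Z_k) a.e. for all k, then the weak*
   limits of these two sequences agree, so that the integrals of v against
   nu_x and of w against mu_x agree for a.e. x. Taking for v a nonnegative
   continuous function with zero set K and w = 0 shows that nu_x is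
   concentrated on K. Applied to Y_k^-1 and Y_k with v ranging over a countable
   family approximating indicators of rational boxes and w = v o g, it shows
   that for a.e. x, mu_x is the push-forward of nu_x under g; this single null
   set then serves all f simultaneously. *)

(** * Boxes with rational corners as a countable base of the matrix topology *)

Section rational_boxes.
Context {R : realType} {m n : nat}.
Implicit Types p : 'M[rat]_(m, n) * 'M[rat]_(m, n).

Definition ratbox p : set 'M[R]_(m, n) :=
  [set A | forall i j, ratr (p.1 i j) < A i j < ratr (p.2 i j)].

(** Each entry of a point of [U] lies between two rationals closer than the radius of a ball inside
    [U], and balls are entrywise. Since the corners range over a countable type, the union is
    countable. *)
Lemma open_bigcup_ratbox (U : set 'M[R]_(m, n)) : open U ->
  U = \bigcup_(p in [set p | ratbox p `<=` U]) ratbox p.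
Proof.
move=> oU; apply/seteqP; split=> [A UA|A [p pU pA]]; last exact: pU.
have /nbhs_ballP[e /= e0 eU] : nbhs A U by exact: open_nbhs_nbhs.
have lo (ij : 'I_m * 'I_n) : {q : rat |
    A ij.1 ij.2 - e < ratr q < A ij.1 ij.2}.
  by apply/cid; have [q] := @rat_in_itvoo R (A ij.1 ij.2 - e) (A ij.1 ij.2)
    ltac:(lra); rewrite in_itv/=; exists q.
have hi (ij : 'I_m * 'I_n) : {q : rat |
    A ij.1 ij.2 < ratr q < A ij.1 ij.2 + e}.
  by apply/cid; have [q] := @rat_in_itvoo R (A ij.1 ij.2) (A ij.1 ij.2 + e)
    ltac:(lra); rewrite in_itv/=; exists q.
exists (\matrix_(i, j) sval (lo (i, j)), \matrix_(i, j) sval (hi (i, j))) => /=.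
- move=> B AB; apply: eU; split=> // i j; rewrite /ball/= ltr_norml.
  move: (AB i j); rewrite /= !mxE.
  have := svalP (lo (i, j)); have := svalP (hi (i, j)) => /=; lra.
- move=> i j; rewrite /= !mxE.
  have := svalP (lo (i, j)); have := svalP (hi (i, j)) => /=; lra.
Qed.

Lemma ratboxI p q : exists r, ratbox p `&` ratbox q = ratbox r.
Proof.
exists (\matrix_(i, j) Num.max (p.1 i j) (q.1 i j),
        \matrix_(i, j) Num.min (p.2 i j) (q.2 i j)).
have maxE (a b : rat) : ratr (Num.max a b) = Num.max (ratr a) (ratr b) :> R.
  by rewrite !maxElt ltr_rat; case: ifP.
have minE (a b : rat) : ratr (Num.min a b) = Num.min (ratr a) (ratr b) :> R.
  by rewrite !minElt ltr_rat; case: ifP.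
apply/seteqP; split=> [A [pA qA] i j|A rA]; last split=> i j.
- by rewrite /= !mxE maxE minE gt_max lt_min andbACA pA qA.
- by move: (rA i j); rewrite /= !mxE maxE minE gt_max lt_min andbACA => /andP[].
- by move: (rA i j); rewrite /= !mxE maxE minE gt_max lt_min andbACA => /andP[].
Qed.

(** Measurability of [h] is expressed through its entries, so that the lemma serves both row vectors
    with Lebesgue sets and square matrices with Borel sets. *)
Lemma ratbox_measurable {d} {T : measurableType d} (h : T -> 'M[R]_(m, n)) p :
  (forall i j, measurable_fun setT (fun x => h x i j)) ->
  measurable (h @^-1` ratbox p).
Proof.
move=> mh; rewrite (_ : _ @^-1` _ = \big[setI/setT]_i \big[setI/setT]_j
  ((fun x => h x i j) @^-1` `]ratr (p.1 i j), ratr (p.2 i j)[)); last first.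
  apply/seteqP; split=> [x px|x].
    rewrite -bigcap_seq => i _; rewrite -bigcap_seq => j _ /=.
    by rewrite in_itv; exact: px.
  rewrite -bigcap_seq => px i j.
  have := px i (mem_index_enum _); rewrite -bigcap_seq.
  by move=> /(_ j (mem_index_enum _)) /=; rewrite in_itv.
apply: bigsetI_measurable => i _; apply: bigsetI_measurable => j _.
by rewrite -[X in measurable X]setTI; apply: mh => //; exact: measurable_itv.
Qed.

Lemma open_preimage_measurable {d} {T : measurableType d}
    (h : T -> 'M[R]_(m, n)) (U : set 'M[R]_(m, n)) :
  (forall i j, measurable_fun setT (fun x => h x i j)) -> open U ->
  measurable (h @^-1` U).
Proof.
move=> mh /open_bigcup_ratbox ->; rewrite preimage_bigcup bigcup_mkcond.
apply: countable_bigcupT_measurable => [|p]; first exact: countableP.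
by case: ifP => _ //; exact: ratbox_measurable.
Qed.

End rational_boxes.

(** * Lebesgue measurability of open sets and finite measure of bounded sets *)

Section lebesgue_measurability.
Context {R : realType} {n : nat}.
Implicit Types (p : 'rV[R]_n.+1 * 'rV[R]_n.+1) (x : 'rV[R]_n.+1) (a : R).

(** [box_below] and [box_above] are the two pieces of a box cut along the hyperplane $x_i = a$. As
    boxes are closed on the upper side, points of the hyperplane go to the lower piece. *)
Definition box_below (i : 'I_n.+1) a p : 'rV[R]_n.+1 * 'rV[R]_n.+1 :=
  (p.1, \row_j if j == i then Num.min (p.2 ord0 j) a else p.2 ord0 j).

Definition box_above (i : 'I_n.+1) a p : 'rV[R]_n.+1 * 'rV[R]_n.+1 :=
  (\row_j if j == i then Num.max (p.1 ord0 j) a else p.1 ord0 j, p.2).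

Lemma box_belowE (i : 'I_n.+1) a p x :
  x ord0 i <= a -> box p x -> box (box_below i a p) x.
Proof.
move=> xa px j; rewrite /= mxE; move: (px j); case: eqP => // -> /andP[-> ].
by rewrite le_min xa andbT.
Qed.

Lemma box_aboveE (i : 'I_n.+1) a p x :
  a < x ord0 i -> box p x -> box (box_above i a p) x.
Proof.
move=> xa px j; rewrite /= mxE; move: (px j); case: eqP => // -> /andP[? ->].
by rewrite gt_max xa andbT; apply/andP.
Qed.

(** Only the factor of index [i] changes, which leaves $\max(0, \min(u,a) - l) + \max(0, u -
    \max(l,a)) = \max(0, u - l)$. *)
Lemma box_volume_split (i : 'I_n.+1) a p :
  (box_volume (box_below i a p) + box_volume (box_above i a p) =
   box_volume p)%E.
Proof.
rewrite /box_volume -EFinD; congr EFin.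
rewrite (bigD1 i)//= [X in _ + X](bigD1 i)//= [RHS](bigD1 i)//= !mxE !eqxx.
under eq_bigr => j /negbTE ji do rewrite !mxE ji.
under [X in _ + _ * X]eq_bigr => j /negbTE ji do rewrite !mxE ji.
rewrite -mulrDl; congr (_ * _).
move: (p.1 _ _) (p.2 _ _) => l u.
by case: (leP u a) => ua; case: (leP l a) => la; rewrite !maxElt;
  repeat (case: ltP => ?); lra.
Qed.

(** Half-spaces satisfy the Caratheodory criterion: cutting every box of a cover of [X] along $x_i =
    a$ yields covers of the two parts of [X], whose volumes add up to that of the given cover. *)
Lemma coordinate_measurable (i : 'I_n.+1) :
  measurable_fun setT (fun x : Rn R n => x ord0 i).
Proof.
apply: (measurability _ (RGenOInfty.measurableE R)) => //.
move=> /= _ [_ [a ->] <-]; rewrite setTI.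
rewrite -[X in measurable X]setCK; apply: measurableC.
apply: le_caratheodory_measurable => X.
apply: le_ereal_inf_tmp => _ [p Xp <-].
rewrite (eq_eseriesr (fun k _ => esym (box_volume_split i a (p k)))).
rewrite nneseriesD; [|by move=> *; exact: box_volume_ge0..].
apply: leeD; apply: ereal_inf_lbound.
- exists (fun k => box_below i a (p k)) => // x [Xx /= xa].
  have [k _ pkx] := Xp _ Xx; exists k => //; apply: box_belowE => //.
  by rewrite leNgt; apply/negP => ax; apply: xa; rewrite in_itv/= ax.
- exists (fun k => box_above i a (p k)) => // x [Xx /contrapT /= xa].
  have [k _ pkx] := Xp _ Xx; exists k => //; apply: box_aboveE => //.
  by move: xa; rewrite in_itv/= andbT.
Qed.

Lemma open_lebesgue_measurable (U : set (Rn R n)) :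
  open (U : set 'rV[R]_n.+1) -> measurable U.
Proof.
move=> oU; rewrite -[U]preimage_id.
apply: (open_preimage_measurable (id : Rn R n -> _)) => // i j.
by rewrite ord1; exact: coordinate_measurable.
Qed.

Lemma bounded_lebesgue_finite (U : set (Rn R n)) :
  bounded_set (U : set 'rV[R]_n.+1) -> (leb U < +oo)%E.
Proof.
move=> [M [_ MU]].
(* [bounded_set] bounds the norm only by numbers above [M], such as $|M| + 1$; one more unit makes
   the lower inequality of the box strict. *)
pose p : 'rV[R]_n.+1 * 'rV[R]_n.+1 :=
  (const_mx (- (`|M| + 2)), const_mx (`|M| + 2)).
have : (leb U <= \sum_(0 <= k <oo)
    box_volume (if k == 0%N then p else (0%R, 0%R)))%E.
  apply: ereal_inf_lbound.
  (* The cover is padded with the degenerate box [(0, 0)], of volume 0 because there is at least one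
     coordinate. *)
  exists (fun k => if k == 0%N then p else (0, 0)) => //.
  move=> x Ux; exists 0%N => // i; rewrite /= !mxE.
  have xM : `|x| <= `|M| + 1 by apply: MU => //; have := ler_norm M; lra.
  suff : `|x ord0 i| <= `|M| + 1 by rewrite ler_norml; lra.
  apply: le_trans xM; rewrite [X in _ <= X]mx_normrE.
  exact: (le_bigmax _ _ (ord0, i)).
move=> /le_lt_trans; apply; rewrite (nneseries_split 0%N 1%N); last first.
  by move=> *; exact: box_volume_ge0.
rewrite eseries0; first by rewrite adde0 add0n big_nat1 ltry.
case=> // k _ _ /=.
by rewrite /box_volume big_ord_recl/= subrr maxxx mul0r.
Qed.

End lebesgue_measurability.

(** * Continuity of determinant, adjugate and Frobenius norm *)

Section matrix_continuity.
Context {R : realType} {T : topologicalType}.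

Lemma continuous_mx {m n : nat} (F : T -> 'M[R]_(m, n)) :
  (forall i j, continuous (fun x => F x i j)) -> continuous F.
Proof.
move=> cF x; apply/cvg_ballP => e e0.
suff : \forall y \near x, forall ij : 'I_m * 'I_n,
    ball (F x ij.1 ij.2) e (F y ij.1 ij.2).
  by apply: filterS => y Fxy; split=> // i j; exact: (Fxy (i, j)).
by apply: filter_forall => -[i j] /=; move/cvg_ballP: (cF i j x); exact.
Qed.

Lemma continuous_sumr {I : Type} (r : seq I) (P : pred I) (F : I -> T -> R) :
  (forall i, continuous (F i)) ->
  continuous (fun x => \sum_(i <- r | P i) F i x).
Proof. by move=> cF; apply: (continuous_big add_continuous) => i _. Qed.

Lemma continuous_prodr {I : Type} (r : seq I) (P : pred I) (F : I -> T -> R) :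
  (forall i, continuous (F i)) ->
  continuous (fun x => \prod_(i <- r | P i) F i x).
Proof. by move=> cF; apply: (continuous_big mul_continuous) => i _. Qed.

Lemma continuous_mulr (f g : T -> R) : continuous f -> continuous g ->
  continuous (fun x => f x * g x).
Proof. by move=> cf cg x; apply: continuousM; [exact: cf|exact: cg]. Qed.

Lemma continuous_addr (f g : T -> R) : continuous f -> continuous g ->
  continuous (fun x => f x + g x).
Proof. by move=> cf cg x; apply: cvgD; [exact: cf|exact: cg]. Qed.

Lemma continuous_subr (f g : T -> R) : continuous f -> continuous g ->
  continuous (fun x => f x - g x).
Proof. by move=> cf cg x; apply: cvgB; [exact: cf|exact: cg]. Qed.

Lemma continuous_invr (f : T -> R) : (forall x, f x != 0) -> continuous f ->
  continuous (fun x => (f x)^-1).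
Proof. by move=> f0 cf x; apply: cvgV => //; exact: cf. Qed.

Lemma continuous_maxr0 (f : T -> R) : continuous f ->
  continuous (fun x => Num.max 0 (f x)).
Proof.
by move=> cf; apply: max_fun_continuous => // x; exact: cst_continuous.
Qed.

Lemma continuous_det {n : nat} (F : T -> 'M[R]_n) :
  (forall i j, continuous (fun x => F x i j)) ->
  continuous (fun x => \det (F x)).
Proof.
move=> cF; rewrite /determinant; apply: continuous_sumr => s.
by apply: continuous_mulr; [exact: cst_continuous|exact: continuous_prodr].
Qed.

Lemma continuous_adj {n : nat} (F : T -> 'M[R]_n) :
  (forall i j, continuous (fun x => F x i j)) ->
  forall i j, continuous (fun x => \adj (F x) i j).
Proof.
move=> cF i j; under [X in continuous X]eq_fun do rewrite mxE /cofactor.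
apply: continuous_mulr; first exact: cst_continuous.
apply: continuous_det => k l.
by under [X in continuous X]eq_fun do rewrite !mxE; exact: cF.
Qed.

Lemma continuous_frobenius {n : nat} (F : T -> 'M[R]_n.+1) :
  (forall i j, continuous (fun x => F x i j)) ->
  continuous (fun x => frobenius (F x)).
Proof.
move=> cF x; apply: (continuous_comp _ (@sqrt_continuous R _)).
apply: continuous_sumr => i; apply: continuous_sumr => j.
exact: continuous_mulr.
Qed.

End matrix_continuity.

(** * [Rrho] as the zero set of a continuous function, and a continuous extension of the inverse *)

Section bounded_inverse.
Context {R : realType} {n : nat}.
Implicit Types (A : 'M[R]_n.+1) (rho : R).

Lemma ler_entry_frobenius A i j : `|A i j| <= frobenius A.
Proof.
rewrite -sqrtr_sqr ler_wsqrtr// (bigD1 i)//= (bigD1 j)//= -addrA lerDl.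
by rewrite addr_ge0// sumr_ge0// => k _; rewrite ?sqr_ge0// sumr_ge0// => l _;
  exact: sqr_ge0.
Qed.

Lemma frobeniusZ a A : frobenius (a *: A) = `|a| * frobenius A.
Proof.
rewrite /frobenius -sqrtr_sqr -sqrtrM ?sqr_ge0//; congr Num.sqrt.
rewrite mulr_sumr; apply: eq_bigr => i _; rewrite mulr_sumr.
by apply: eq_bigr => j _; rewrite mxE exprMn.
Qed.

(** Crude bound for the Leibniz formula: $(n+1)!$ terms, each a product of $n+1$ entries of modulus
    at most [rho]. *)
Definition det_bound rho : R := (n.+1)`!%:R * rho ^+ n.+1.

Lemma det_bound_gt0 rho : 0 < rho -> 0 < det_bound rho.
Proof. by move=> r0; rewrite mulr_gt0 ?exprn_gt0// ltr0n fact_gt0. Qed.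

Lemma ler_norm_det A rho : frobenius A <= rho -> `|\det A| <= det_bound rho.
Proof.
move=> Arho; apply: (le_trans (ler_norm_sum _ _ _)).
apply: (@le_trans _ _ (\sum_(s : 'S_n.+1) rho ^+ n.+1)); last first.
  by rewrite sumr_const card_Sn -mulr_natl.
apply: ler_sum => s _; rewrite normrM normrX normrN1 expr1n mul1r normr_prod.
rewrite -[X in _ <= _ ^+ X]card_ord -prodr_const.
apply: ler_prod => i _; rewrite normr_ge0/=.
exact: le_trans (ler_entry_frobenius _ _ _) Arho.
Qed.

(* The last summand enforces the lower bound on the determinant that the bound
   on the inverse implies; without it, A = 0 could be a zero. *)
Definition Rrho_excess rho A : R :=
  Num.max 0 (frobenius A - rho) +
  Num.max 0 (frobenius (\adj A) - rho * `|\det A|) +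
  Num.max 0 (1 - det_bound rho * `|\det A|).

Lemma Rrho_excess_ge0 rho A : 0 <= Rrho_excess rho A.
Proof. by rewrite !addr_ge0// le_max lexx. Qed.

(** $1 = |\det A^{-1}|\,|\det A|$, and the determinant bound applies to $A^{-1}$, whose norm is also
    at most [rho]. *)
Lemma Rrho_det rho A : Rrho rho A -> 1 <= det_bound rho * `|\det A|.
Proof.
move=> [uA]; rewrite ge_max => /andP[_ iA].
rewrite -[X in X <= _](@normr1 R) -(@det1 R n.+1) -(mulVmx uA) det_mulmx normrM.
by rewrite ler_wpM2r// ler_norm_det.
Qed.

Lemma frobenius_invmx A : A \in unitmx ->
  frobenius (invmx A) = frobenius (\adj A) / `|\det A|.
Proof.
by move=> uA; rewrite /invmx uA frobeniusZ mulrC normrV.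
Qed.

(** The three summands are nonnegative, so the sum vanishes only if each does. The third then forces
    $\det A \neq 0$, and the second, divided by $|\det A|$, bounds $|A^{-1}| = |\operatorname{adj}
    A| / |\det A|$. *)
Lemma Rrho_excessP rho A : Rrho rho A <-> Rrho_excess rho A = 0.
Proof.
have m0 (x : R) : 0 <= Num.max 0 x by rewrite le_max lexx.
split=> [RA|/eqP].
  have dA := Rrho_det _ _ RA; move: RA => [uA]; rewrite ge_max => /andP[Arho].
  have dA0 : 0 < `|\det A| by rewrite normr_gt0 -unitfE -unitmxE.
  rewrite frobenius_invmx// ler_pdivrMr// => iA.
  by rewrite /Rrho_excess !max_l ?addr0// subr_le0.
have eqmax (x : R) : (Num.max 0 x == 0) = (x <= 0) by rewrite eq_maxl.
rewrite !paddr_eq0 ?addr_ge0// !eqmax !subr_le0 => /andP[/andP[Arho iA] dA].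
have uA : A \in unitmx.
  rewrite unitmxE unitfE; apply: contraTneq dA => ->.
  by rewrite normr0 mulr0 ler10.
split=> //; rewrite ge_max Arho frobenius_invmx//=.
by rewrite ler_pdivrMr// normr_gt0 -unitfE -unitmxE.
Qed.

Lemma continuous_Rrho_excess rho : continuous (Rrho_excess rho).
Proof.
have cid := @coord_continuous R n.+1 n.+1.
have cdet : continuous (fun A : 'M[R]_n.+1 => `|\det A|).
  move=> A; apply: continuous_comp; last exact: norm_continuous.
  exact: (continuous_det id).
rewrite /Rrho_excess; apply: continuous_addr; first apply: continuous_addr.
- apply: continuous_maxr0; apply: continuous_subr; last exact: cst_continuous.
  exact: (continuous_frobenius id).
- apply: continuous_maxr0; apply: continuous_subr.
    by apply: continuous_frobenius => i j; exact: (continuous_adj id).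
  by apply: continuous_mulr => // C; exact: cst_continuous.
- apply: continuous_maxr0; apply: continuous_subr; first exact: cst_continuous.
  by apply: continuous_mulr => // C; exact: cst_continuous.
Qed.

Lemma closed_Rrho rho : closed (Rrho rho : set 'M[R]_n.+1).
Proof.
rewrite (_ : Rrho rho = Rrho_excess rho @^-1` [set 0]).
  apply: closed_comp; last exact: closed_eq.
  by move=> A _; exact: continuous_Rrho_excess.
by apply/seteqP; split=> A /Rrho_excessP.
Qed.

Lemma Rrho_invmx rho A : Rrho rho A -> Rrho rho (invmx A).
Proof. by move=> [uA rA]; split; rewrite ?unitmx_inv// invmxK maxC. Qed.

(** The positive denominator gives continuity at singular matrices too, as required of test
    functions in [generates]. The threshold is the lower bound of $(\det A)^2$ on [Rrho] given by
    [Rrho_det], so that there the maximum is $(\det A)^2$. *)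
Definition invmx_ext rho A : 'M[R]_n.+1 :=
  (\det A / Num.max (\det A ^+ 2) (det_bound rho ^- 2)) *: \adj A.

Lemma invmx_extE rho A : 0 < rho -> Rrho rho A -> invmx_ext rho A = invmx A.
Proof.
move=> r0 RA; have b0 := det_bound_gt0 _ r0.
have dA := Rrho_det _ _ RA; have uA := RA.1.
rewrite /invmx_ext max_l.
  by rewrite /invmx uA expr2 invfM mulrA divff ?mul1r// -unitfE -unitmxE.
have iA : (det_bound rho)^-1 <= `|\det A|.
  by rewrite -[leLHS]mul1r ler_pdivrMr// mulrC.
rewrite -exprVn -[leRHS]real_normK ?num_real//.
by rewrite ler_pXn2r// nnegrE ?invr_ge0 ltW.
Qed.

Lemma continuous_invmx_ext rho : 0 < rho -> continuous (invmx_ext rho).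
Proof.
move=> r0; have cid := @coord_continuous R n.+1 n.+1.
have b0 := det_bound_gt0 _ r0.
have cdet : continuous (fun A : 'M[R]_n.+1 => \det A).
  exact: (continuous_det id).
apply: continuous_mx => i j.
under [X in continuous X]eq_fun do rewrite mxE.
apply: continuous_mulr; last exact: (continuous_adj id).
apply: continuous_mulr => //; apply: continuous_invr => [A|].
  by apply: lt0r_neq0; rewrite lt_max invr_gt0 (exprn_gt0 _ b0) orbT.
apply: max_fun_continuous; last by move=> B; exact: cst_continuous.
exact: continuous_mulr.
Qed.

End bounded_inverse.

(** * Borel measures on matrices and their values on rational boxes *)

Section matrix_measures.
Context {R : realType} {n : nat}.
Implicit Types (D : set (Mn R n)).

Lemma open_measurable_Mn (U : set 'M[R]_n.+1) : open U ->
  measurable (U : set (Mn R n)).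
Proof. by move=> oU; exact: sub_sigma_algebra. Qed.

Lemma within_continuous_measurable D (f : 'M[R]_n.+1 -> R) :
  measurable D -> {within (D : set 'M[R]_n.+1), continuous f} ->
  measurable_fun D (f : Mn R n -> R).
Proof.
move=> mD /continuousP cf.
apply: (measurability _ (RGenOpens.measurableE R)) => //.
move=> _ [_ [a [b ->]] <-].
have /cf/open_subspaceP[V oV VD] : open (`]a, b[%classic : set R).
  exact: interval_open.
by rewrite setIC -VD; apply: measurableI => //; exact: open_measurable_Mn.
Qed.

Lemma continuous_measurable_real (f : 'M[R]_n.+1 -> R) D :
  continuous f -> measurable_fun D (f : Mn R n -> R).
Proof.
move=> cf; apply: (measurable_funS (E := setT)) => //.
apply: within_continuous_measurable => //.
exact: continuous_subspaceT.
Qed.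

Lemma continuous_measurable_Mn (g : 'M[R]_n.+1 -> 'M[R]_n.+1) :
  continuous g -> measurable_fun setT (g : Mn R n -> Mn R n).
Proof.
move=> /continuousP cg.
apply: (@measurability _ _ (Mn R n) (Mn R n) _ _ (@open 'M[R]_n.+1)) => //.
by move=> _ [U oU <-]; rewrite setTI; apply: open_measurable_Mn; exact: cg.
Qed.

Lemma ratbox_measurable_Mn p : measurable (ratbox p : set (Mn R n)).
Proof.
rewrite -[X in measurable X]preimage_id.
apply: (ratbox_measurable (id : Mn R n -> _)) => i j.
by apply: continuous_measurable_real; exact: coord_continuous.
Qed.

(** Rational boxes are stable under intersection, generate the Borel sets, and contain a sequence
    [g] of finite mass covering the space; two measures equal on them coincide. *)
Lemma Mn_measure_unique (m1 m2 : {measure set (Mn R n) -> \bar R}) :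
  (m1 setT < +oo)%E -> (forall p, m1 (ratbox p) = m2 (ratbox p)) ->
  forall A, measurable A -> m1 A = m2 A.
Proof.
move=> m1oo m12 A mA.
pose G : set (set (Mn R n)) := range ratbox.
pose g k : set (Mn R n) := ratbox (const_mx (- k%:R), const_mx k%:R).
apply: (g_sigma_algebra_measure_unique G _ g _ _ m1 m2).
- by move=> _ [p _ <-]; exact: ratbox_measurable_Mn.
- by move=> k; exists (const_mx (- k%:R), const_mx k%:R).
- apply/seteqP; split=> // B _.
  have [k kB] : exists k : nat, frobenius B < k%:R.
    exists (Num.truncn (frobenius B)).+1; exact: truncnS_gt.
  exists k => // i j; rewrite /= !mxE rmorphN/= ratr_nat -ltr_norml.
  exact: le_lt_trans (ler_entry_frobenius _ _ _) kB.
- move=> _ _ [p _ <-] [q _ <-]; have [r ->] := ratboxI (R := R) p q.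
  by exists r.
- by move=> _ [p _ <-]; exact: m12.
- move=> k; apply: le_lt_trans m1oo; apply: le_measure; rewrite ?inE//.
  exact: ratbox_measurable_Mn.
- suff oG : (open : set (set 'M[R]_n.+1)) `<=` <<s G >>.
    exact: (smallest_sub (smallest_sigma_algebra setT G) oG).
  move=> U /open_bigcup_ratbox ->; rewrite bigcup_mkcond.
  apply: (@countable_bigcupT_measurable _ (g_sigma_algebraType G)) => [|p].
    exact: countableP.
  by case: ifP => _; [apply: sub_sigma_algebra; exists p|exact: measurable0].
Qed.

(** A continuous function that is positive exactly on the open box; its multiples cut off at 1
    increase to the indicator of the box. *)
Definition tent (p : 'M[rat]_n.+1 * 'M[rat]_n.+1) (A : 'M[R]_n.+1) : R :=
  \prod_i \prod_j
    (Num.max 0 (A i j - ratr (p.1 i j)) * Num.max 0 (ratr (p.2 i j) - A i j)).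

Lemma tent_ge0 p A : 0 <= tent p A.
Proof.
apply: prodr_ge0 => i _; apply: prodr_ge0 => j _.
by rewrite mulr_ge0 ?le_max ?lexx.
Qed.

Lemma tent_gt0 p A : ratbox p A -> 0 < tent p A.
Proof.
move=> pA; apply: prodr_gt0 => i _; apply: prodr_gt0 => j _.
by have /andP[? ?] := pA i j; apply: mulr_gt0; rewrite lt_max subr_gt0 ltxx.
Qed.

Lemma tent_eq0 p A : ~ ratbox p A -> tent p A = 0.
Proof.
move=> /existsNP[i /existsNP[j /negP]]; rewrite negb_and -!leNgt => pA.
rewrite /tent (bigD1 i)//= (bigD1 j)//=; case/orP: pA => pA.
- by rewrite [Num.max 0 (A i j - _)]max_l ?subr_le0// !mul0r.
- by rewrite [Num.max 0 (_ - A i j)]max_l ?subr_le0// mulr0 !mul0r.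
Qed.

Lemma continuous_tent p : continuous (tent p).
Proof.
have cid := @coord_continuous R n.+1 n.+1.
apply: continuous_prodr => i; apply: continuous_prodr => j.
apply: continuous_mulr; apply: continuous_maxr0; apply: continuous_subr;
  by [exact: cid|exact: cst_continuous].
Qed.

Definition box_approx p (k : nat) (A : 'M[R]_n.+1) : R :=
  Num.min 1 (k%:R * tent p A).

Lemma continuous_box_approx p k : continuous (box_approx p k).
Proof.
apply: min_fun_continuous; first by move=> A; exact: cst_continuous.
apply: continuous_mulr; last exact: continuous_tent.
by move=> A; exact: cst_continuous.
Qed.

Lemma box_approx_ge0 p k A : 0 <= box_approx p k A.
Proof. by rewrite le_min ler01 mulr_ge0// tent_ge0. Qed.

Lemma box_approx_le1 p k A : box_approx p k A <= 1.
Proof. by rewrite ge_min lexx. Qed.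

Lemma box_approx_nondecreasing p A :
  nondecreasing_seq (fun k => box_approx p k A).
Proof.
move=> k l kl; rewrite le_min ge_min lexx/= ge_min ler_wpM2r ?orbT//.
  exact: tent_ge0.
by rewrite ler_nat.
Qed.

(** The sequence is eventually constant: it is 0 off the box, and inside it equals 1 once $k \ge
    1/\mathtt{tent}\,p\,A$. *)
Lemma cvg_box_approx p A :
  (box_approx p k A)%:E @[k --> \oo] --> ((\1_(ratbox p) A)%:E : \bar R).
Proof.
apply: cvg_EFin; first exact: nearW.
apply: cvg_near_cst; rewrite /comp/= indicE.
have [pA|pA] := pselect (ratbox p A); last first.
  apply: nearW => k; rewrite memNset// /box_approx tent_eq0// mulr0.
  by rewrite min_r.
have t0 := tent_gt0 _ _ pA.
exists (Num.truncn (tent p A)^-1).+1 => // k /= kp.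
rewrite mem_set// /box_approx min_l// -ler_pdivrMr// mul1r.
by rewrite (le_trans (ltW (truncnS_gt _)))// ler_nat.
Qed.

Lemma cvg_integral_box_approx (m : {measure set (Mn R n) -> \bar R}) p :
  (\int[m]_A (box_approx p k A)%:E @[k --> \oo] --> m (ratbox p))%E.
Proof.
have mba k : measurable_fun setT (fun A : Mn R n => (box_approx p k A)%:E).
  apply/measurable_EFinP; apply: continuous_measurable_real.
  exact: continuous_box_approx.
have -> : m (ratbox p) = (\int[m]_A (\1_(ratbox p) A)%:E)%E.
  by rewrite integral_indic ?setIT//; exact: ratbox_measurable_Mn.
rewrite (eq_integral (fun A : Mn R n => limn (fun k => (box_approx p k A)%:E))).
  apply: cvg_monotone_convergence => //.
  - by move=> k A _; rewrite lee_fin box_approx_ge0.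
  - by move=> A _ k l kl; rewrite lee_fin; exact: box_approx_nondecreasing.
by move=> A _; apply/esym/cvg_lim => //; exact: cvg_box_approx.
Qed.

End matrix_measures.

(** * Null sets, vanishing integrals and change of variables *)

Section measure_lemmas.
Context {d : measure_display} {T : measurableType d} {R : realType}.
Implicit Types (m : {measure set T -> \bar R}) (D : set T).

Lemma ae_forall_countable {I : countType} m (P : I -> T -> Prop) :
  (forall i, {ae m, forall x, P i x}) -> {ae m, forall x, forall i, P i x}.
Proof.
move=> mP.
have : {ae m, forall x, forall k, if unpickle k is Some i then P i x else True}.
  by apply: ae_foralln => k; case: unpickle => [i|]; [exact: mP|exact: aeW].
by apply: filterS => x Px i; have := Px (pickle i); rewrite pickleK.
Qed.

Lemma ae_bounded_integrable m D (f : T -> R) :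
  measurable D -> (m D < +oo)%E -> measurable_fun D f ->
  (exists M : R, {ae m, forall x, D x -> `|f x| <= M}) ->
  m.-integrable D (EFin \o f).
Proof.
move=> mD Doo mf [M fM]; apply/integrableP.
split; first exact/measurable_EFinP.
apply: (@le_lt_trans _ _ (`|M|%:E * m D)%E).
  apply: integral_le_bound => //; first exact/measurable_EFinP.
  apply: filterS fM => x fxM Dx; rewrite lee_fin.
  exact: le_trans (fxM Dx) (ler_norm _).
by rewrite lte_mul_pinfty.
Qed.

Lemma Rintegral_eq0_ae m D (f : T -> R) :
  measurable D -> m.-integrable D (EFin \o f) ->
  (forall x, D x -> 0 <= f x) -> \int[m]_(x in D) f x = 0 ->
  {ae m, forall x, D x -> f x = 0}.
Proof.
move=> mD intf f0 If0.
have : (\int[m]_(x in D) `|(EFin \o f) x| = 0)%E.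
  rewrite (eq_integral (fun x => (f x)%:E)); last first.
    by move=> x /set_mem Dx /=; rewrite ger0_norm// f0.
  (* Integrability excludes an infinite integral, whose real part [fine] would be 0 as well. *)
  by rewrite -[LHS]fineK ?(integrable_fin_num _ intf)//; congr EFin.
move/(ae_eq_integral_abs m mD (measurable_int _ intf)).
by apply: filterS => x fx0 /fx0 [].
Qed.

Lemma ae_eq_Rintegral m D (f g : T -> R) :
  measurable D -> measurable_fun D f -> measurable_fun D g ->
  {ae m, forall x, D x -> f x = g x} ->
  \int[m]_(x in D) f x = \int[m]_(x in D) g x.
Proof.
move=> mD mf mg fg; congr fine.
apply: ae_eq_integral => //; try exact/measurable_EFinP.
by apply: filterS fg => x fgx Dx; rewrite fgx.
Qed.

(** For nonnegative integrands, change of variables gives an integral over [phi @^-1]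
    D[, which differs from]D[by a subset of the]m2[-null set]~[D]. The general case follows from
    positive and negative parts. *)
Lemma integral_concentrated_pushforward m1 m2 (phi : {mfun T >-> T}) D
    (f : T -> R) :
  measurable D -> D `<=` phi @^-1` D -> m2 (~` D) = 0%E ->
  (forall A, measurable A -> m1 A = m2 (phi @^-1` A)) ->
  measurable_fun D f ->
  (\int[m1]_(x in D) (f x)%:E = \int[m2]_(x in D) (f (phi x))%:E)%E.
Proof.
move=> mD Dphi mDC m12 mf.
have mphiD : measurable (phi @^-1` D).
  by rewrite -[X in measurable X]setTI; exact: measurable_funPT.
have ge0 (F : T -> \bar R) : measurable_fun D F -> (forall x, (0 <= F x)%E) ->
    (\int[m1]_(x in D) F x = \int[m2]_(x in D) F (phi x))%E.
  move=> mF F0; rewrite (eq_measure_integral (pushforward m2 phi)).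
    rewrite ge0_integral_pushforward//.
    have mC : measurable (~` D) by exact: measurableC.
    have mFphi : measurable_fun (phi @^-1` D) (F \o phi).
      apply: (measurable_comp mD) => //; first by move=> _ [x Dx <-].
      exact: measurable_funP.
    rewrite (ge0_negligible_integral mC)//; last by move=> x _; exact: F0.
    by rewrite setDE setCK setIidr.
  by move=> A mA _; exact: m12.
have mEf : measurable_fun D (EFin \o f) by exact/measurable_EFinP.
rewrite integralE [RHS]integralE; congr (_ - _)%E.
- rewrite (ge0 _ (measurable_funepos mEf)) => [|x]; last exact: funepos_ge0.
  by apply: eq_integral => x _; rewrite !funeposE.
- rewrite (ge0 _ (measurable_funeneg mEf)) => [|x]; last exact: funeneg_ge0.
  by apply: eq_integral => x _; rewrite !funenegE.
Qed.

End measure_lemmas.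

(** * Almost everywhere uniqueness of weak-star limits, applied to Young measures *)

Section weak_star_limits.
Context {R : realType} {n : nat}.
Variable Omega : set (Rn R n).
Hypotheses (mOmega : measurable Omega) (Omega_fin : (leb Omega < +oo)%E).

(** Both convergences are tested against the truncated difference [phi] of the limits. The integrals
    along the sequences agree, so $\int (l - l')\phi = 0$ with a nonnegative integrand, which
    therefore vanishes almost everywhere. *)
Lemma weak_star_cvg_ae_eq (u u' : nat -> Rn R n -> R) (l l' : Rn R n -> R) :
  weak_star_cvg Omega u l -> weak_star_cvg Omega u' l' ->
  (forall k, {ae leb, forall x, Omega x -> u k x = u' k x}) ->
  {ae leb, forall x, Omega x -> l x = l' x}.
Proof.
move=> [Lu Ll ul] [Lu' Ll' ul'] uu'.
have [[ml _] [ml' _]] := (Ll, Ll').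
(* Truncation keeps phi bounded while (l - l') * phi vanishes only where
   l = l'. *)
pose phi x := Num.max (-1) (Num.min 1 (l x - l' x)).
have mphi : measurable_fun Omega phi.
  apply: measurable_maxr; first exact: measurable_cst.
  apply: measurable_minr; first exact: measurable_cst.
  exact: measurable_funB.
have phi1 x : `|phi x| <= 1.
  by rewrite ler_norml /phi le_max lexx/= ge_max ge_min lexx; lra.
have iphi : leb.-integrable Omega (EFin \o phi).
  by apply: ae_bounded_integrable => //; exists 1; exact: aeW.
have int_phi (v : Rn R n -> R) : Linfty Omega v ->
    leb.-integrable Omega (EFin \o (fun x => v x * phi x)).
  move=> [mv [N vN]]; apply: ae_bounded_integrable => //.
    exact: measurable_funM.
  exists N; apply: filterS vN => x vxN /vxN; apply: le_trans.
  by rewrite normrM ler_piMr.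
have il := int_phi l Ll.
have il' := int_phi l' Ll'.
have ll' : \int[leb]_(x in Omega) (l x * phi x) =
           \int[leb]_(x in Omega) (l' x * phi x).
  apply: (cvg_unique _ (ul _ iphi)) => //.
  rewrite (_ : (fun k => _) = fun k => \int[leb]_(x in Omega) (u' k x * phi x)).
    exact: ul'.
  apply/funext => k; apply: ae_eq_Rintegral => //.
  - by apply: measurable_funM => //; exact: (Lu k).1.
  - by apply: measurable_funM => //; exact: (Lu' k).1.
  - by apply: filterS (uu' k) => x uux /uux ->.
have : {ae leb, forall x, Omega x -> l x * phi x - l' x * phi x = 0}.
  apply: Rintegral_eq0_ae => //.
  - exact: integrableB il il'.
  - move=> x _; rewrite -mulrBl /phi; set t := l x - l' x.
    case: (leP 1 t) => t1; first by case: (leP (-1)) => ?; nra.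
    by case: (leP (-1) t) => ?; [rewrite -expr2 sqr_ge0|nra].
  - by rewrite RintegralB// ll' subrr.
apply: filterS => x lx /lx /eqP; rewrite -mulrBl mulf_eq0 subr_eq0.
case/orP => [/eqP //|/eqP]; rewrite /phi.
by case: (leP 1 (l x - l' x)) => ?; case: (leP (-1)) => ?; lra.
Qed.

(** The exceptional null set depends on [v] and [w], so a common one is available only for countably
    many pairs. *)
Lemma generates_ae_eq (Y Z : nat -> Rn R n -> Mn R n)
    (nu mu : Rn R n -> probability (Mn R n) R) (v w : 'M[R]_n.+1 -> R) :
  generates Omega Y nu -> generates Omega Z mu ->
  continuous v -> continuous w ->
  {ae leb, forall x, Omega x -> forall k, v (Y k x) = w (Z k x)} ->
  {ae leb, forall x, Omega x ->
    \int[nu x]_s v s = \int[mu x]_s w s}.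
Proof.
move=> [_ Ynu] [_ Zmu] cv cw vw.
apply: (weak_star_cvg_ae_eq _ _ _ _ (Ynu v cv).2 (Zmu w cw).2) => k.
by apply: filterS vw => x vwx Ox; exact: vwx.
Qed.

Lemma generates_concentrated (Y : nat -> Rn R n -> Mn R n)
    (nu : Rn R n -> probability (Mn R n) R) (v : 'M[R]_n.+1 -> R) :
  generates Omega Y nu -> continuous v -> (forall A, 0 <= v A) ->
  {ae leb, forall x, Omega x -> forall k, v (Y k x) = 0} ->
  {ae leb, forall x, Omega x -> nu x [set A | v A != 0] = 0%E}.
Proof.
move=> Ynu cv v0 vY.
have c0 : continuous (cst 0 : 'M[R]_n.+1 -> R).
  by move=> A; exact: cst_continuous.
have v_int := (Ynu.2 v cv).1.
(* [Y] is compared with itself, for the test functions [v] and 0. Integrability of [v] turns the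
   zero integral into vanishing of [v] almost everywhere for [nu x]. *)
apply: filterS2 (generates_ae_eq _ _ _ _ _ _ Ynu Ynu cv c0 vY) v_int.
move=> x + iv Ox => /(_ Ox); rewrite /= Rintegral_cst// mul0r.
move=> /(Rintegral_eq0_ae _ _ _ measurableT (iv Ox) (fun A _ => v0 A)).
have mv : measurable ([set A | v A != 0] : set (Mn R n)).
  rewrite (_ : [set A | _] = setT `&` v @^-1` (~` [set 0])).
    apply: (continuous_measurable_real v) => //; exact: measurableC.
  by apply/seteqP; split=> A /= => [/eqP|[_ /eqP]].
case=> N [mN N0 vN]; apply: (subset_measure0 mv mN _ N0) => A /= /eqP vA.
by apply: vN => /= /(_ Logic.I).
Qed.

End weak_star_limits.

(** * The Young measure of the inverses as a push-forward *)

Section inverse_young_measure.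
Context {R : realType} {n : nat}.

Lemma generates_invmx (Omega : set (Rn R n)) (rho : R)
    (Y : nat -> Rn R n -> Mn R n) (nu mu : Rn R n -> probability (Mn R n) R) :
  measurable Omega -> (leb Omega < +oo)%E -> 0 < rho ->
  {ae leb, forall x, Omega x -> forall k, Rrho rho (Y k x)} ->
  generates Omega Y nu ->
  generates Omega (fun k x => invmx (Y k x)) mu ->
  {ae leb, forall x, Omega x ->
    forall f : 'M[R]_n.+1 -> R, {within Rrho rho, continuous f} ->
      (\int[mu x]_(s in Rrho rho) (f s)%:E =
       \int[nu x]_(s in Rrho rho) (f (invmx s))%:E)%E} /\
  {ae leb, forall x, Omega x -> supp (nu x) `<=` Rrho rho}.
Proof.
move=> mOmega Omega_fin hrho hYrho hYnu hYmu.
have mRrho : measurable (Rrho rho : set (Mn R n)).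
  rewrite -[X in measurable X]setCK; apply: measurableC.
  by apply: open_measurable_Mn; apply: closed_openC; exact: closed_Rrho.
have conc : {ae leb, forall x, Omega x -> nu x (~` Rrho rho) = 0%E}.
  have : {ae leb, forall x, Omega x -> forall k,
      Rrho_excess rho (Y k x) = 0}.
    by apply: filterS hYrho => x Yx Ox k; apply/Rrho_excessP; exact: Yx.
  move=> /(generates_concentrated _ mOmega Omega_fin _ _ _ hYnu
    (continuous_Rrho_excess rho) (Rrho_excess_ge0 rho)).
  apply: filterS => x nux Ox; rewrite -(nux Ox); congr (nu x _).
  by apply/seteqP; split=> A /= => [nA|/eqP nA]; [apply/eqP|];
    move/Rrho_excessP.
split; last first.
  (* The complement of [Rrho] is open and null for [nu x], so it contains no point of the
     support. *)
  apply: filterS conc => x nux Ox A supA; apply: contrapT => nA.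
  have := supA (~` Rrho rho) (closed_openC (closed_Rrho rho)) nA.
  by rewrite nux// ltxx.
have cinv := @continuous_invmx_ext R n rho hrho.
pose phi : {mfun Mn R n >-> Mn R n} :=
  mfun_Sub (mem_set (continuous_measurable_Mn _ cinv)).
have approx : {ae leb, forall x, forall pk, Omega x ->
    \int[mu x]_s box_approx pk.1 pk.2 s =
    \int[nu x]_s box_approx pk.1 pk.2 (invmx_ext rho s)}.
  (* Boxes and levels form a countable type, which yields one null set for all of them. *)
  apply: ae_forall_countable => pk.
  have cv := @continuous_box_approx R n pk.1 pk.2.
  have cw : continuous (fun s => box_approx pk.1 pk.2 (invmx_ext rho s)).
    by move=> A; apply: continuous_comp; [exact: cinv|exact: cv].
  apply: (generates_ae_eq _ mOmega Omega_fin _ _ _ _ _ _ hYmu hYnu cv cw).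
  by apply: filterS hYrho => x Yx Ox k; rewrite invmx_extE//; exact: Yx.
apply: filterS2 approx conc => x apx nux Ox f cf.
have mu_nu A : measurable A -> mu x A = nu x (phi @^-1` A).
  have mbox p k : measurable_fun setT (box_approx p k : Mn R n -> R).
    by apply: continuous_measurable_real; exact: continuous_box_approx.
  have int_fin (m : probability (Mn R n) R) p k (g : Mn R n -> Mn R n) :
      measurable_fun setT g ->
      m.-integrable setT (fun s => (box_approx p k (g s))%:E).
    move=> mg; apply: ae_bounded_integrable => //.
    - exact: le_lt_trans (probability_le1 m measurableT) (ltry 1).
    - exact: (measurableT_comp (mbox p k) mg).
    - exists 1; apply: aeW => s _.
      by rewrite ger0_norm ?box_approx_ge0 ?box_approx_le1.
  apply: (Mn_measure_unique (mu x) (pushforward (nu x) phi)) => [|p].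
    exact: le_lt_trans (probability_le1 (mu x) measurableT) (ltry 1).
  (* The masses of the box under [mu x] and under the push-forward are limits of the same sequence
     of integrals. *)
  have /cvg_unique := cvg_integral_box_approx (mu x) p; apply => //.
  rewrite (_ : (fun k => _) = fun k =>
      (\int[pushforward (nu x) phi]_A (box_approx p k A)%:E)%E).
    exact: cvg_integral_box_approx.
  apply/funext => k; rewrite ge0_integral_pushforward//; last 2 first.
  - by apply/measurable_EFinP; exact: mbox.
  - by move=> s _; rewrite lee_fin box_approx_ge0.
  (* [apx] equates real-valued integrals; finiteness lifts this to the extended reals. *)
  have mu_fin := integrable_fin_num measurableT
    (int_fin (mu x) p k _ (@measurable_id _ _ _)).
  have nu_fin := integrable_fin_num measurableT
    (int_fin (nu x) p k _ (measurable_funPT phi)).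
  rewrite preimage_setT -(fineK mu_fin) -(fineK nu_fin).
  by congr EFin; exact: (apx (p, k) Ox).
(* Here [D] is [Rrho], which [phi] maps into itself because inversion does and [phi] is inversion
   there. *)
rewrite (integral_concentrated_pushforward _ (nu x) phi) //.
- by apply: eq_integral => s /set_mem Rs; rewrite /= invmx_extE.
- by move=> s Rs /=; rewrite invmx_extE//; exact: Rrho_invmx.
- exact: nux.
- exact: within_continuous_measurable.
Qed.

End inverse_young_measure.

Theorem proposition3p7 (R : realType) (n : nat) (Omega : set 'rV[R]_n.+1)
    (hOmega : bounded_lipschitz_domain Omega) (rho : R) (hrho : 0 < rho)
    (Y : nat -> Rn R n -> Mn R n)
    (hY : forall k, Linfty_mx Omega (Y k))
    (hYrho : {ae @leb R n, forall x, Omega x -> forall k, Rrho rho (Y k x)})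
    (nu mu : Rn R n -> probability (Mn R n) R)
    (hnu : Yinfty Omega nu) (hmu : Yinfty Omega mu)
    (hYnu : generates Omega Y nu)
    (hYmu : generates Omega (fun k x => invmx (Y k x)) mu) :
  {ae @leb R n, forall x, Omega x ->
    forall f : 'M[R]_n.+1 -> R, {within Rrho rho, continuous f} ->
      (\int[mu x]_(s in Rrho rho) (f s)%:E =
       \int[nu x]_(s in Rrho rho) (f (invmx s))%:E)%E} /\
  {ae @leb R n, forall x, Omega x -> supp (nu x) `<=` Rrho rho}.
Proof.
have [[oOmega _ _] bOmega _] := hOmega.
apply: (generates_invmx (Omega : set (Rn R n)) rho Y) => //.
- exact: open_lebesgue_measurable.
- exact: bounded_lebesgue_finite.
Qed.
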